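(* There is no product structure $\Pi=(A,B,P)$, even or odd, with $|A|,|B|\ge 2$ that admits a coherent orientation $O$ such that $(\Pi,O)$ is no-fold and satisfies the triple-girth condition $\mathsf T_4$, i.e. such that at least one of the following holds: (1) $\operatorname{girth}(L_{AB})\ge 6$ and $\operatorname{girth}(L_1)\ge 6$; (2) $\operatorname{girth}(L_{AB})\ge 4$ and $\operatorname{girth}(L_1)\ge 8$; (3) $\operatorname{girth}(L_{AB})\ge 3$ and $\operatorname{girth}(L_1)\ge 12$.
   Context: A product structure of type $(m,n)$ is a triple $\Pi=(A,B,P)$ with $A,B$ finite (disjoint) sets, $|A|=m$, $|B|=n$, and $P$ a partition of $A\times B$ into cells such that if two distinct positions $(a,b),(a',b')$ lie in the same cell then $a\ne a'$ and $b\ne b'$. It is even if every cell has size $2$, and odd if exactly one cell has size $1$ and all others have size $2$. Horizontal graphs: $L_A$ is the simple graph on vertex set $A$ in which $\{a,a'\}$ is an edge iff there are $b,b'\in B$ with $\{(a,b),(a',b')\}\in P$; $L_B$ is the simple graph on $B$ in which $\{b,b'\}$ is an edge iff there are $a,a'\in A$ with $\{(a,b),(a',b')\}\in P$. $L_{AB}=L_A\sqcup L_B$. Colors are the classes of the equivalence relation on $E(L_A)\sqcup E(L_B)$ generated by declaring, for each 2-cell $\{(a,b),(a',b')\}$, the edge $\{a,a'\}$ equivalent to the edge $\{b,b'\}$. A coherent orientation $O$ is a choice of one direction for each edge of $L_A$ and $L_B$ such that for every 2-cell $\{(a,b),(a',b')\}$ either $a\to a'$ and $b\to b'$, or $a'\to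 a$ and $b'\to b$. $(\Pi,O)$ is no-fold if no vertex of $A\sqcup B$ has two distinct outgoing edges of the same color or two distinct incoming edges of the same color. Given $O$, each color $c$ has two signed colors $(c,\mathrm{out}),(c,\mathrm{in})$. The middle link $L_1$ is the simple bipartite graph with parts $A\sqcup B$ and the set of signed colors, where $v$ is adjacent to $(c,\mathrm{out})$ iff $v$ is the tail of some edge of color $c$, and to $(c,\mathrm{in})$ iff $v$ is the head of some edge of color $c$. Girth is the length of a shortest cycle, $\infty$ for acyclic graphs; the girth of a disconnected graph is the minimum over its components. *)

(* Defs.v *)
From mathcomp Require Import all_boot.

Set Implicit Arguments.
Unset Strict Implicit.
Unset Printing Implicit Defensive.

(* Girth of a simple graph, given as a symmetric irreflexive relation. *)
Section Girth.
Variables (T : finType) (e : rel T).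

Definition simple_cycle (c : seq T) : bool := (2 < size c) && ucycleb e c.

Definition has_cycle_of_size (k : nat) : bool :=
  [exists c : k.-tuple T, simple_cycle c].

(* The vertices of a cycle are distinct, so cycles of length at most #|T|
   suffice; [None] stands for the infinite girth of an acyclic graph. *)
Definition girth : option nat :=
  let k := find has_cycle_of_size (iota 0 #|T|.+1) in
  if k <= #|T| then Some k else None.

Definition girth_at_least (k : nat) : bool :=
  if girth is Some g then k <= g else true.

Lemma girth_at_leastP (k : nat) :
  girth_at_least k <-> (forall c : seq T, simple_cycle c -> k <= size c).
Proof.
have sz c : simple_cycle c -> size c <= #|T|.
  by case/and3P=> _ _ /card_uniqP <-; apply: max_card.
have has_sz c : simple_cycle c -> has_cycle_of_size (size c).
  by move=> cc; apply/existsP; exists (in_tuple c).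
rewrite /girth_at_least /girth; set g := find _ _.
have g_min c : simple_cycle c -> g <= size c.
  move=> cc; rewrite leqNgt; apply/negP => /(before_find 0).
  by rewrite nth_iota ?ltnS ?sz // add0n has_sz.
case: leqP => [le_g | gt_g]; split=> //.
- by move=> le_k c /g_min; apply: leq_trans.
- move=> H; have: has has_cycle_of_size (iota 0 #|T|.+1).
    by rewrite has_find size_iota.
  move=> /(nth_find 0); rewrite -/g nth_iota // add0n.
  by case/existsP=> c /H; rewrite size_tuple.
- by move=> _ c cc; have := leq_trans (g_min c cc) (sz c cc); rewrite leqNgt gt_g.
Qed.

End Girth.

(* Disjointness of the two sides is built in: A and B are distinct summands of
   the vertex type [A + B]. *)
Record product_structure (A B : finType) := ProductStructure {
  cells :> {set {set A * B}};
  cells_partition : partition cells [set: A * B];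
  cells_generic : forall (c : {set A * B}) (p q : A * B),
    c \in cells -> p \in c -> q \in c -> p != q ->
    (p.1 != q.1) && (p.2 != q.2)
}.

Section ProductStructures.
Variables (A B : finType) (Pi : product_structure A B).

Definition even_structure : Prop := forall c, c \in cells Pi -> #|c| = 2.

Definition odd_structure : Prop :=
  exists2 c0, c0 \in cells Pi &
    #|c0| = 1 /\ (forall c, c \in cells Pi -> c != c0 -> #|c| = 2).

Definition two_cell (a : A) (b : B) (a' : A) (b' : B) : bool :=
  ((a, b) != (a', b')) && ([set (a, b); (a', b')] \in cells Pi).

Definition link_A : rel A := fun a a' =>
  [exists b, exists b', two_cell a b a' b'].

Definition link_B : rel B := fun b b' =>
  [exists a, exists a', two_cell a b a' b'].

Definition link_AB : rel (A + B) := fun u v =>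
  match u, v with
  | inl a, inl a' => link_A a a'
  | inr b, inr b' => link_B b b'
  | _, _ => false
  end.

Lemma two_cellC a b a' b' : two_cell a b a' b' = two_cell a' b' a b.
Proof. by rewrite /two_cell eq_sym setUC. Qed.

Lemma two_cell_neq a b a' b' :
  two_cell a b a' b' -> (a != a') && (b != b').
Proof.
case/andP=> ne inP.
exact: (cells_generic inP (set21 _ _) (set22 _ _) ne).
Qed.

Lemma link_AB_sym : symmetric link_AB.
Proof.
by case=> u [] v //=; apply/existsP/existsP => -[x /existsP[y c]];
  exists y; apply/existsP; exists x; rewrite two_cellC.
Qed.

Lemma link_AB_irr : irreflexive link_AB.
Proof.
by case=> u /=; apply/existsP => -[x /existsP[y /two_cell_neq]];
  rewrite eqxx ?andbF.
Qed.

Definition link_edges : {set {set A + B}} :=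
  [set [set uv.1; uv.2] | uv : (A + B) * (A + B) & link_AB uv.1 uv.2].

Definition color_step : rel {set A + B} := fun e f =>
  [exists a, exists b, exists a', exists b',
    [&& two_cell a b a' b', e == [set inl a; inl a']
      & f == [set inr b; inr b']]].

Definition same_color : rel {set A + B} :=
  connect (fun e f => color_step e f || color_step f e).

Definition colors : {set {set {set A + B}}} :=
  equivalence_partition same_color link_edges.

Definition color : finType := {c : {set {set A + B}} | c \in colors}.

(* [arc u v] means that the edge {u, v} is directed from u to v. *)
Record coherent_orientation := CoherentOrientation {
  arc :> rel (A + B);
  arc_edge : forall u v, arc u v -> link_AB u v;
  arc_choice : forall u v, link_AB u v -> arc u v (+) arc v u;
  arc_coherent : forall a b a' b', two_cell a b a' b' ->
    (arc (inl a) (inl a') /\ arc (inr b) (inr b')) \/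
    (arc (inl a') (inl a) /\ arc (inr b') (inr b))
}.

Variable O : coherent_orientation.

Definition no_fold : Prop :=
  (forall v w w', O v w -> O v w' ->
     same_color [set v; w] [set v; w'] -> w = w') /\
  (forall v w w', O w v -> O w' v ->
     same_color [set w; v] [set w'; v] -> w = w').

(* (c, true) is the signed color (c, out), and (c, false) is (c, in). *)
Definition signed_color : finType := (color * bool)%type.

Definition incident (v : A + B) (s : signed_color) : bool :=
  [exists w, ([set v; w] \in val s.1) && (if s.2 then O v w else O w v)].

Definition middle_link : rel ((A + B) + signed_color) := fun x y =>
  match x, y with
  | inl v, inr s => incident v s
  | inr s, inl v => incident v s
  | _, _ => false
  end.

Definition triple_girth_T4 : Prop :=
  [\/ girth_at_least link_AB 6 /\ girth_at_least middle_link 6,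
      girth_at_least link_AB 4 /\ girth_at_least middle_link 8
    | girth_at_least link_AB 3 /\ girth_at_least middle_link 12].

End ProductStructures.

(* Main.v *)
(* Regard the vertices of A and B as points and the signed colors as lines.
   Every pair in A x B, except possibly one, lies on a line, because it lies in
   a 2-cell; girth(L_1) >= 6 says that two points share at most one line; and the
   degree of a vertex in L_AB is at least the number of lines through it.  Let X
   be the smaller and Y the larger of the two sides.
   If girth(L_1) >= 8 there are no triangles of lines, which forces every line to
   contain at most one point of Y; a vertex of X then lies on |Y| lines, so its
   degree is at least |Y| >= |X|, which is absurd.
   If girth(L_AB) >= 6, let Q be the largest number of points of Y on a line s.
   By no-fold the opposite line of s has Q points of Y as well, and the two lines
   share at most one point v.  Any other x in X misses one of them, and the Q
   lines joining x to the points of Y on the missed line show deg x >= Q.  As the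
   lines through v cover Y, the sum of deg x over the neighbors x of v is at least
   Q deg v >= |Y|, and the ball of radius 2 around v has more than |Y| elements.
   In the odd case the exceptional pair costs 1, which is recovered from a point
   at distance 3 from v. *)
Require Import Defs.
From mathcomp Require Import all_boot.
From mathcomp Require Import zify.

Set Implicit Arguments.
Unset Strict Implicit.
Unset Printing Implicit Defensive.

Lemma leq_card_bigcup (I T : finType) (P : pred I) (F : I -> {set T}) :
  #|\bigcup_(i | P i) F i| <= \sum_(i | P i) #|F i|.
Proof.
elim/big_ind2: _ => [|m A n B leA leB|//]; first by rewrite cards0.
by apply: leq_trans (leq_add leA leB); apply: leq_card_setU.
Qed.

(** * Counting vertices within distance two in graphs without triangles and squares *)

Section SmallBalls.
Variables (V : finType) (e : rel V).
Hypotheses (e_sym : symmetric e) (e_irr : irreflexive e).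
Hypothesis no_triangle : forall a b c, e a b -> e b c -> e c a -> False.
Hypothesis no_square : forall a b c d,
  a != c -> b != d -> e a b -> e b c -> e c d -> e d a -> False.

(** Without triangles and squares, the paths of length two from [v] inject into the vertices at
    distance one or two. [W] adds [v] itself and vertices at distance at least three. *)
Lemma second_ball_bound (X W : {set V}) (v : V) :
    (forall x y, e x y -> x \in X -> y \in X) -> v \in X -> W \subset X ->
    (forall w, w \in W -> ~~ e v w) ->
    (forall w x, w \in W -> e v x -> e x w -> w = v) ->
    v \in W ->
  \sum_(x | e v x) #|[set y | e x y]| + #|W| <= #|X|.
Proof.
move=> eX vX WX W1 W2 vW.
pose P := [set p : V * V | e v p.1 && e p.1 p.2].
have ->: \sum_(x | e v x) #|[set y | e x y]| = #|P|.
  under eq_bigr => x _ do rewrite -sum1_card.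
  rewrite pair_big_dep -sum1_card; apply: eq_bigl => -[x y].
  by rewrite !inE.
(* An edge returning to v from x stands for x itself. *)
pose f (p : V * V) := if p.2 == v then p.1 else p.2.
have injf : {in P &, injective f}.
  move=> [x y] [x' y']; rewrite !inE /f /= => /andP[vx xy] /andP[vx' xy'].
  (* A collision gives a triangle through [v] in the two mixed cases, and a square through [v] in
     the last. *)
  case: eqP => [yv|/eqP yv]; case: eqP => [yv'|/eqP yv'] eq_f.
  - by rewrite eq_f yv yv'.
  - rewrite -eq_f in xy'.
    by case: (no_triangle vx' xy'); rewrite e_sym.
  - rewrite eq_f in xy.
    by case: (no_triangle vx xy); rewrite e_sym.
  - rewrite eq_f in xy *; case: (eqVneq x x') => [-> //|nx].
    rewrite eq_sym in yv'.
    by case: (no_square yv' nx vx xy); rewrite e_sym.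
rewrite -(card_in_imset injf) -cardsUI.
have ->: [set f x | x in P] :&: W = set0.
  apply/setP=> w; rewrite !inE; apply/negP=> /andP[/imsetP[[x y]]].
  rewrite inE /f /= => /andP[vx xy] -> wW.
  move: wW; case: eqP => [_ /W1|/eqP nyv wW]; first by rewrite vx.
  by move: nyv; rewrite (W2 _ _ wW vx xy) eqxx.
rewrite cards0 addn0; apply: subset_leq_card; rewrite subUset WX andbT.
apply/subsetP=> w /imsetP[[x y]]; rewrite inE /f /= => /andP[vx xy] ->.
by have xX := eX _ _ vx vX; case: ifP => _ //; apply: eX xy xX.
Qed.

End SmallBalls.

(** * Lines meeting in at most one point, with the degree bounding the lines through a point *)

(* The sets D and E contain the two coordinates of the pair that may be
   uncovered; both are empty for even structures. *)
Section Lines.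
Variables (V S : finType) (e : rel V) (I : V -> S -> bool) (flip : S -> S).
Variables X Y D E : {set V}.

Definition line_size (s : S) := #|[set y in Y | I y s]|.
Definition degree (v : V) := #|[set w | e v w]|.

Hypotheses (e_sym : symmetric e) (e_irr : irreflexive e).
Hypothesis eX : forall x y, e x y -> x \in X -> y \in X.
Hypothesis lines_le_degree : forall v, #|[set s | I v s]| <= degree v.
Hypothesis linear : forall v w s t,
  v != w -> I v s -> I w s -> I v t -> I w t -> s = t.
Hypothesis flip_neq : forall s, s != flip s.
Hypothesis size_flip : forall s, line_size (flip s) = line_size s.
Hypotheses (D_le1 : #|D| <= 1) (E_le1 : #|E| <= 1).
Hypothesis covered : forall x y,
  x \in X -> y \in Y -> (x \in D -> y \notin E) -> exists s, I x s && I y s.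
Hypotheses (X_gt0 : 0 < #|X|) (Y_gt1 : 1 < #|Y|) (X_le_Y : #|X| <= #|Y|).

(** Union bound: the lines through [x] cover [Z], except for the point of [E] when [x] lies in
    [D]. *)
Lemma cover_bound (x : V) (Z : {set V}) :
  x \in X -> Z \subset Y ->
  #|Z| <= \sum_(t | I x t) #|[set z in Z | I z t]| + (x \in D).
Proof.
move=> xX ZY; pose F := if x \in D then E else set0.
have F_le : #|F| <= (x \in D).
  by rewrite /F; case: (x \in D); rewrite ?cards0.
apply: leq_trans (leq_add (leq_card_bigcup _ _) F_le).
apply: leq_trans (leq_card_setU _ _); apply: subset_leq_card.
apply/subsetP=> z zZ; rewrite inE orbC; apply/orP.
case: (boolP (z \in F)) => [|zF]; first by left.
right; have [|s /andP[xs zs]] := covered xX (subsetP ZY _ zZ).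
  by move=> xD; move: zF; rewrite /F xD.
by apply/bigcupP; exists s => //; rewrite inE zZ.
Qed.

Lemma line_size_sum (x : V) : x \in X ->
  #|Y| <= \sum_(t | I x t) line_size t + (x \in D).
Proof. by move=> xX; apply: cover_bound. Qed.

(** A line through [x] differs from [s], so by linearity it covers at most one point of [s]. *)
Lemma line_size_le_degree (x : V) (s : S) : x \in X -> ~~ I x s ->
  line_size s <= degree x + (x \in D).
Proof.
move=> xX xs.
have sub : [set y in Y | I y s] \subset Y by apply/subsetP=> y /setIdP[].
apply: leq_trans (cover_bound xX sub) _; rewrite leq_add2r.
apply: leq_trans (lines_le_degree x); rewrite -sum1dep_card.
apply: leq_sum => t xt; apply/card_le1_eqP => y y'.
rewrite !inE => /andP[/andP[_ ys] yt] /andP[/andP[_ ys'] yt'].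
apply/eqP; case: eqVneq => // ny.
by move: xs; rewrite (linear ny ys' ys yt' yt) xt.
Qed.

Lemma line_size_mul_degree (x : V) (Q : nat) :
  (forall s, line_size s <= Q) -> x \in X ->
  #|Y| <= degree x * Q + (x \in D).
Proof.
move=> maxQ xX; apply: leq_trans (line_size_sum xX) _; rewrite leq_add2r.
apply: leq_trans (leq_mul (lines_le_degree x) (leqnn _)).
by rewrite -sum_nat_cond_const; apply: leq_sum => s _; apply: maxQ.
Qed.

Lemma common_points_eq (s : S) (v w : V) :
  I v s -> I v (flip s) -> I w s -> I w (flip s) -> v = w.
Proof.
move=> vs vf ws wf; apply/eqP; case: eqVneq => // nvw.
by have /eqP := flip_neq s; case; apply: linear nvw vs ws vf wf.
Qed.

(** Inclusion-exclusion: [s] and [flip s] have equally many points in [Y] and share at most one. *)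
Lemma double_line_size (s : S) : (line_size s).*2 <= #|Y|.+1.
Proof.
rewrite -addnn -{2}size_flip /line_size -cardsUI -addn1; apply: leq_add.
  by apply: subset_leq_card; apply/subsetP=> y; rewrite !inE => /orP[]/andP[].
apply/card_le1_eqP => y y'; rewrite !inE.
move=> /andP[/andP[_ ys] /andP[_ yf]] /andP[/andP[_ ys'] /andP[_ yf']].
exact: common_points_eq ys' yf' ys yf.
Qed.

Lemma no_girth8_lines :
    (forall u v w r s t,
      u != v -> v != w -> u != w -> r != s -> s != t -> r != t ->
      I u r -> I v r -> I v s -> I w s -> I w t -> I u t -> False) ->
    1 < #|X :\: D| -> False.
Proof.
move=> no_hexagon /card_gt1P[x1 [x2 [/setDP[x1X x1D] /setDP[x2X x2D] n12]]].
(* Otherwise [s] and the lines joining [x] to two points of [s] form a triangle. *)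
have on_line s x : 1 < line_size s -> x \in X -> x \notin D -> I x s.
  move=> /card_gt1P[y1 [y2 [/setIdP[y1Y y1s] /setIdP[y2Y y2s] ny]]] xX xD.
  have cov y : y \in Y -> exists t, I x t && I y t.
    by move=> yY; apply: covered => //; rewrite (negPf xD).
  have [t1 /andP[xt1 yt1]] := cov _ y1Y.
  have [t2 /andP[xt2 yt2]] := cov _ y2Y.
  apply/negPn/negP=> xs.
  have nst t : I x t -> s != t by move=> xt; apply: contraNneq xs => ->.
  have nxy y : I y s -> x != y by move=> ys; apply: contraNneq xs => ->.
  have nt : t1 != t2.
    apply/eqP=> eq_t; rewrite -eq_t in yt2.
    have /eqP[] := nst _ xt1; exact: linear ny y1s y2s yt1 yt2.
  apply: (@no_hexagon x y1 y2 t1 s t2) => //; try exact: nxy.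
    by rewrite eq_sym; apply: nst.
  exact: nst.
(* A larger line and its flip would both contain [x1] and [x2]. *)
have size_le1 s : line_size s <= 1.
  rewrite leqNgt; apply/negP=> s2; have /eqP[] := n12.
  by apply: (@common_points_eq s); apply: on_line; rewrite ?size_flip.
have := line_size_mul_degree size_le1 x1X.
rewrite (negPf x1D) addn0 muln1 leqNgt; case/negP.
apply: leq_trans X_le_Y; apply: proper_card; apply/properP; split.
  by apply/subsetP=> w; rewrite inE => /eX; apply.
by exists x1; rewrite ?inE ?e_irr.
Qed.

Lemma no_girth6_lines :
    (forall a b c, e a b -> e b c -> e c a -> False) ->
    (forall a b c d, a != c -> b != d ->
      e a b -> e b c -> e c d -> e d a -> False) ->
    (forall a b c d f,
      e a b -> e b c -> e c d -> e d f -> e f a -> False) ->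
  False.
Proof.
move=> no_triangle no_square no_pentagon.
have [x0 x0X] : exists x, x \in X by apply/card_gt0P.
(* The maximum needs some line to exist; with none, at most one point of [Y] could be accounted
   for. *)
have [t0 _] : exists t : S, true.
  case: (pickP (fun _ : S => true)) => [t _|noS]; first by exists t.
  have := line_size_sum x0X; rewrite big_pred0 => [|t]; last by case/idP: (noS t).
  by case: (x0 \in D) => /=; lia.
have [s _ /= maxs] := @arg_maxnP S t0 xpredT line_size isT.
set Q := line_size s in maxs; have {}maxs t : line_size t <= Q by apply: maxs.
have Q2 : Q.*2 <= #|Y|.+1 := double_line_size s.
(* Degree at most one would give |Y| <= Q, against 2Q <= |Y| + 1 and |Y| > 1. *)
have degree_gt1 x : x \in X -> x \notin D -> 1 < degree x.
  move=> xX xD; have := line_size_mul_degree maxs xX.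
  by rewrite (negPf xD); case: (degree x) => [|[|]] //=; lia.
(* v is the common point in X of s and flip s, if there is one. *)
have [v vX degQ] : exists2 v, v \in X &
    forall x, x \in X -> x != v -> Q <= degree x + (x \in D).
  have [v] : exists v, v \in X /\
      forall x, x \in X -> x != v -> ~~ (I x s && I x (flip s)).
    case: (pickP [pred x in X | I x s && I x (flip s)]) => [v|none].
      move=> /andP[vX /andP[vs vf]]; exists v; split=> // x xX.
      by apply: contraNN => /andP[xs xf]; rewrite (common_points_eq xs xf vs vf).
    by exists x0; split=> // x xX _; have /= := none x; rewrite xX /= => ->.
  case=> vX off; exists v => // x xX /(off _ xX); rewrite negb_and.
  by case/orP=> xs; first exact: line_size_le_degree xs;
    rewrite /Q -size_flip; apply: line_size_le_degree.
have nbr_neq x : e v x -> x != v by apply: contraTneq => ->; rewrite e_irr.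
have ball W := second_ball_bound (W := W) e_sym no_triangle no_square eX vX.
have sumD (P : pred V) : \sum_(x | P x) (x \in D) = #|[set x in D | P x]|.
  by rewrite -sum1dep_card big_mkcond /= [RHS]big_mkcond /=; apply: eq_bigr => x _;
    case: (P x); case: (x \in D).
(* Each neighbor of [v] accounts for one factor [Q]; the corrections add up to the part of [D] in
   the closed neighborhood of [v]. *)
have lower : #|Y| <= \sum_(x | e v x) degree x + #|[set x in D | e v x || (x == v)]|.
  apply: leq_trans (line_size_mul_degree maxs vX) _.
  have ->: #|[set x in D | e v x || (x == v)]| = #|[set x in D | e v x]| + (v \in D).
    rewrite -!sumD [LHS](bigID (e v)) /=; congr (_ + _).
      by apply: eq_bigl => x; case: (e v x); rewrite ?andbF.
    rewrite (big_pred1 v) // => x /=; case: eqP => [->|_]; first by rewrite e_irr.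
    by case: (e v x).
  rewrite addnA leq_add2r -sumD -big_split /= /degree -sum1dep_card big_distrl /=.
  by apply: leq_sum => x vx; rewrite mul1n; apply: degQ; rewrite ?nbr_neq ?(eX vx).
case: (posnP #|[set x in D | e v x || (x == v)]|) => [D0 | /card_gt0P[z]].
  have : \sum_(x | e v x) degree x + #|[set v]| <= #|X|.
    apply: ball; rewrite ?sub1set ?set11 // => w.
      by move=> /set1P->; rewrite e_irr.
    by move=> x /set1P->.
  rewrite cards1 addn1; move: lower; rewrite D0 addn0 => lower.
  by move=> /(leq_ltn_trans lower); rewrite ltnNge X_le_Y.
(* The correction is now one. A path [v], [x], [y], [w] ending at distance three puts a second point
   into [W] and makes up for it; [x] and [y] avoid [D] so that their degrees allow the path to
   continue. *)
move=> /setIdP[zD zv].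
have onlyz x : x \in D -> x = z.
  by move=> xD; apply: (card_le1_eqP D_le1).
have [x vx xD] : exists2 x, e v x & x \notin D.
  case/orP: zv => [vz | /eqP zv].
    have nvz : v != z by rewrite eq_sym nbr_neq.
    have vD : v \notin D by apply: contra nvz => /onlyz->.
    have /card_gt1P[x1 [x2 []]] := degree_gt1 _ vX vD; rewrite !inE => v1 v2 n12.
    case: (eqVneq x1 z) => [eq1|n1]; last first.
      by exists x1 => //; apply: contra n1 => /onlyz->.
    by exists x2 => //; apply: contra n12 => /onlyz->; rewrite eq1.
  have : 0 < degree v.
    by have := line_size_mul_degree maxs vX; case: (degree v) => //; case: (v \in D); lia.
  case/card_gt0P => x; rewrite inE => vx; exists x => //.
  by apply: contra (nbr_neq _ vx) => /onlyz->; rewrite zv.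
have next a b : e a b -> b \in X -> b \notin D -> exists2 w, e b w & w != a.
  move=> ab bX bD; have /card_gt1P[b1 [b2 []]] := degree_gt1 _ bX bD.
  rewrite !inE => bb1 bb2 n12; case: (eqVneq b1 a) => [eq1|n1]; last by exists b1.
  by exists b2 => //; rewrite -eq1 eq_sym.
have xX := eX vx vX.
have [y xy yv] := next _ _ vx xX xD.
have yX := eX xy xX.
have yD : y \notin D.
  apply/negP=> /onlyz yz; rewrite -yz (negPf yv) orbF e_sym in zv.
  exact: no_triangle vx xy zv.
have [w yw wx] := next _ _ xy yX yD.
have wX := eX yw yX.
have nvw : ~~ e v w.
  rewrite eq_sym in yv; rewrite eq_sym in wx.
  by apply/negP; rewrite e_sym; apply: no_square vx xy yw.
have vw : v != w.
  apply/eqP=> vw; rewrite -vw in yw; exact: no_triangle vx xy yw.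
have : \sum_(x | e v x) degree x + #|[set v; w]| <= #|X|.
  apply: ball.
  - by apply/subsetP=> u; rewrite !inE => /orP[]/eqP->.
  - by move=> u; rewrite !inE => /orP[]/eqP->; rewrite ?e_irr.
  - move=> u x'; rewrite !inE => /orP[/eqP-> //|/eqP->] vx' xw'.
    rewrite e_sym in vx'; rewrite e_sym in xw'.
    (* A common neighbor of [v] and [w] would close a pentagon. *)
    by case: (no_pentagon _ _ _ _ _ vx xy yw xw' vx').
  - by rewrite !inE eqxx.
have exc_le1 : #|[set x in D | e v x || (x == v)]| <= 1.
  by apply: leq_trans D_le1; apply: subset_leq_card; apply/subsetP=> u /setIdP[].
rewrite cards2 vw addn2 => upper.
have := leq_trans lower (leq_add (leqnn _) exc_le1).
by rewrite addn1 => /leq_ltn_trans/(_ upper); rewrite ltnNge X_le_Y.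
Qed.

End Lines.

(** * Short closed walks excluded by the girth *)

Section Girth.
Variables (T : finType) (e : rel T).
Hypothesis e_irr : irreflexive e.

Lemma girth_at_least_leq (k l : nat) :
  k <= l -> girth_at_least e l -> girth_at_least e k.
Proof.
move=> le_kl /girth_at_leastP girth_l; apply/girth_at_leastP => c /girth_l.
exact: leq_trans.
Qed.

Let edge_neq a b : e a b -> a != b.
Proof. by apply: contraTneq => ->; rewrite e_irr. Qed.

Lemma no_triangle_of_girth a b c :
  girth_at_least e 4 -> e a b -> e b c -> e c a -> False.
Proof.
move=> /girth_at_leastP girth4 ab bc ca; have := girth4 [:: a; b; c].
have ac : a != c by rewrite eq_sym edge_neq.
rewrite /simple_cycle /ucycleb /= !inE ab bc ca negb_or ac.
by rewrite (edge_neq ab) (edge_neq bc) => /(_ isT).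
Qed.

Lemma no_square_of_girth a b c d :
  girth_at_least e 5 -> a != c -> b != d ->
  e a b -> e b c -> e c d -> e d a -> False.
Proof.
move=> /girth_at_leastP girth5 ac bd ab bc cd da.
have ad : a != d by rewrite eq_sym edge_neq.
have := girth5 [:: a; b; c; d].
rewrite /simple_cycle /ucycleb /= !inE ab bc cd da !negb_or ac bd ad.
by rewrite (edge_neq ab) (edge_neq bc) (edge_neq cd) => /(_ isT).
Qed.

Lemma no_pentagon_of_girth a b c d f :
  girth_at_least e 6 ->
  e a b -> e b c -> e c d -> e d f -> e f a -> False.
Proof.
move=> girth6 ab bc cd df fa.
have girth4 := girth_at_least_leq (isT : 4 <= 6) girth6.
(* If two vertices two steps apart coincide, the other three edges of the closed walk form a
   triangle. *)
have neq2 x y z t u : e x y -> e y z -> e z t -> e t u -> e u x -> x != z.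
  move=> xy yz zt tu ux; apply/eqP=> xz; rewrite -xz in zt.
  exact: no_triangle_of_girth girth4 zt tu ux.
have /girth_at_leastP/(_ [:: a; b; c; d; f]) := girth6.
rewrite /simple_cycle /ucycleb /= !inE ab bc cd df fa !negb_or.
rewrite (edge_neq ab) (edge_neq bc) (edge_neq cd) (edge_neq df).
rewrite [a == f]eq_sym (edge_neq fa).
rewrite (neq2 _ _ _ _ _ ab bc cd df fa) (neq2 _ _ _ _ _ bc cd df fa ab).
rewrite (neq2 _ _ _ _ _ cd df fa ab bc).
rewrite [a == d]eq_sym (neq2 _ _ _ _ _ df fa ab bc cd).
rewrite [b == f]eq_sym (neq2 _ _ _ _ _ fa ab bc cd df).
by move/(_ isT).
Qed.

End Girth.

(** * Signed colors as lines on the vertices of a product structure *)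

Section Structure.
Variables (A B : finType) (Pi : product_structure A B).

Lemma same_color_equiv : equivalence_rel (same_color Pi).
Proof.
apply/equivalence_relP; split=> [x|x y xy z]; first exact: connect0.
by apply: same_connect xy z; apply: sym_connect_sym => f g; rewrite orbC.
Qed.

Lemma colors_same (c : color Pi) (f g : {set A + B}) :
  f \in val c -> g \in val c -> same_color Pi f g.
Proof.
case: c => c /= /imsetP[h _ ->]; rewrite !inE => /andP[_ hf] /andP[_ hg].
by rewrite -(same_color_equiv h f g).2.
Qed.

Lemma colors_meet (c c' : color Pi) (f : {set A + B}) :
  f \in val c -> f \in val c' -> c = c'.
Proof.
case: c c' => [c cP] [c' cP'] /= fc fc'; apply: val_inj => /=.
case/imsetP: cP fc => h _ ->; case/imsetP: cP' fc' => h' _ ->.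
rewrite !inE => /andP[_ h'f] /andP[_ hf]; apply/setP=> g; rewrite !inE.
by rewrite (same_color_equiv h f g).2 // (same_color_equiv h' f g).2.
Qed.

Lemma color_of_edge (f : {set A + B}) : f \in link_edges Pi ->
  exists c : color Pi, val c = [set g in link_edges Pi | same_color Pi f g].
Proof.
move=> fE; have cP : [set g in link_edges Pi | same_color Pi f g] \in colors Pi.
  exact: imset_f.
by exists (@exist _ (fun c => c \in colors Pi) _ cP).
Qed.

Variable O : coherent_orientation Pi.

Definition flip_sign (s : signed_color Pi) : signed_color Pi := (s.1, ~~ s.2).

Lemma arc_antisym u v : O u v -> O v u = false.
Proof. by move=> uv; have := arc_choice O (arc_edge uv); rewrite uv; case: (O v u). Qed.

(** Choosing a neighbor for each signed color at [v] is injective: the edge determines the color and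
    its direction the sign. *)
Lemma lines_le_degree v :
  #|[set s | incident O v s]| <= degree (link_AB Pi) v.
Proof.
(* The default [v] occurs only for signed colors not incident with [v]. *)
pose f (s : signed_color Pi) := odflt v [pick w |
  ([set v; w] \in val s.1) && (if s.2 then O v w else O w v)].
have fP s : incident O v s ->
    ([set v; f s] \in val s.1) && (if s.2 then O v (f s) else O (f s) v).
  move=> /existsP[w wP]; rewrite /f; case: pickP => //= none.
  by move: (none w); rewrite wP.
have injf : {in [set s | incident O v s] &, injective f}.
  move=> [c b] [c' b']; rewrite !inE => /fP/andP[/= cf of1] /fP/andP[/= cf' of2] ff.
  rewrite -ff in cf' of2; rewrite (colors_meet cf cf'); congr (_, _).
  by case: b b' of1 of2 {ff cf cf'} => [] [] //= /arc_antisym ->.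
rewrite -(card_in_imset injf); apply: subset_leq_card; apply/subsetP=> w.
case/imsetP=> s; rewrite !inE => /fP/andP[_ arc_s] ->.
by move: arc_s; case: ifP => _ /arc_edge //; rewrite link_AB_sym.
Qed.

Lemma two_cell_edge a b a' b' : two_cell Pi a b a' b' ->
  link_A Pi a a' /\ link_B Pi b b'.
Proof.
by move=> cab; split; apply/existsP; [exists b|exists a]; apply/existsP;
  [exists b'|exists a'].
Qed.

(** The two edges of a 2-cell share a color by definition and, by coherence, the sign at [a] and
    [b]. *)
Lemma two_cell_incident a b a' b' : two_cell Pi a b a' b' ->
  exists s, incident O (inl a) s && incident O (inr b) s.
Proof.
move=> cab; have [aa bb] := two_cell_edge cab.
have eA : [set inl a; inl a'] \in link_edges Pi.
  by apply/imsetP; exists (inl a, inl a'); rewrite ?inE.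
have eB : [set inr b; inr b'] \in link_edges Pi.
  by apply/imsetP; exists (inr b, inr b'); rewrite ?inE.
have [c def_c] := color_of_edge eA.
have cA : [set inl a; inl a'] \in val c by rewrite def_c inE eA; apply: connect0.
have cB : [set inr b; inr b'] \in val c.
  rewrite def_c inE eB; apply: connect1; apply/orP; left.
  apply/existsP; exists a; apply/existsP; exists b.
  apply/existsP; exists a'; apply/existsP; exists b'.
  by rewrite cab !eqxx.
case: (arc_coherent O cab) => -[oA oB].
  exists (c, true); apply/andP; split; apply/existsP.
    by exists (inl a'); rewrite cA.
  by exists (inr b'); rewrite cB.
exists (c, false); apply/andP; split; apply/existsP.
  by exists (inl a'); rewrite cA.
by exists (inr b'); rewrite cB.
Qed.

Definition link_closed (Y : {set A + B}) :=
  forall u v, link_AB Pi u v -> u \in Y -> v \in Y.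

(** Moving along an edge of the color to its other end is injective by no-fold and stays in [Y].
    This gives one inequality, and the other follows since flipping is an involution. *)
Lemma line_size_flip (Y : {set A + B}) (s : signed_color Pi) :
    no_fold O -> link_closed Y ->
  line_size (incident O) Y (flip_sign s) = line_size (incident O) Y s.
Proof.
move=> [fold1 fold2] clY.
have le t : line_size (incident O) Y t <= line_size (incident O) Y (flip_sign t).
  case: t => c b.
  pose P v w := ([set v; w] \in val c) && (if b then O v w else O w v).
  pose f v := odflt v [pick w | P v w].
  have fP v : incident O v (c, b) -> P v (f v).
    move=> /existsP[w wP]; rewrite /f; case: pickP => //= none.
    by move: (none w); rewrite /P wP.
  have injf : {in [set y in Y | incident O y (c, b)] &, injective f}.
    move=> v v'; rewrite !inE => /andP[_ /fP/andP[cv ov]] /andP[_ /fP/andP[cv' ov']] ff.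
    rewrite -ff in cv' ov'; move: ov ov'; case: (b) => ov ov'.
      by apply: fold2 ov ov' _; apply: colors_same cv cv'.
    by apply: fold1 ov ov' _; rewrite ![[set f v; _]]setUC; apply: colors_same cv cv'.
  rewrite /line_size -(card_in_imset injf); apply: subset_leq_card.
  apply/subsetP=> w /imsetP[v]; rewrite !inE => /andP[vY /fP/andP[cv ov]] ->.
  apply/andP; split.
    apply: clY vY; move: ov; case: (b) => /arc_edge //; by rewrite link_AB_sym.
  by apply/existsP; exists v; rewrite setUC cv /=; move: ov; case: (b).
apply/eqP; rewrite eqn_leq le andbT; apply: leq_trans (le _) _.
by case: s => c b; rewrite /flip_sign /= negbK.
Qed.

Lemma middle_link_irr : irreflexive (middle_link O).
Proof. by case. Qed.

Lemma incident_linear v w s t :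
    girth_at_least (middle_link O) 6 ->
    v != w -> incident O v s -> incident O w s ->
    incident O v t -> incident O w t -> s = t.
Proof.
move=> girth6 vw vs ws vt wt; apply/eqP; case: (eqVneq s t) => // st.
have girth5 := girth_at_least_leq (isT : 5 <= 6) girth6.
case: (@no_square_of_girth _ _ middle_link_irr
  (inl v) (inr s) (inl w) (inr t) girth5) => //.
Qed.

Lemma incident_no_hexagon u v w r s t :
    girth_at_least (middle_link O) 8 ->
    u != v -> v != w -> u != w -> r != s -> s != t -> r != t ->
    incident O u r -> incident O v r -> incident O v s -> incident O w s ->
    incident O w t -> incident O u t -> False.
Proof.
move=> /girth_at_leastP/(_ [:: inl u; inr r; inl v; inr s; inl w; inr t]) girth8.
move=> uv vw uw rs st rt ur vr vs ws wt ut; move: girth8.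
rewrite /simple_cycle /ucycleb /= ur vr vs ws wt ut !inE !negb_or /=.
rewrite !(inj_eq inl_inj, inj_eq inr_inj) uv vw uw rs st rt.
by move/(_ isT).
Qed.

Lemma two_cell_of_pair (c : {set A * B}) (a : A) (b : B) :
    c \in cells Pi -> #|c| = 2 -> (a, b) \in c ->
  exists a' b', two_cell Pi a b a' b'.
Proof.
move=> cP /eqP/cards2P[[a1 b1] [[a2 b2] [n12 def_c]]].
rewrite def_c in cP *; case/set2P=> -[-> ->].
  by exists a2, b2; rewrite /two_cell n12.
by exists a1, b1; rewrite two_cellC /two_cell n12.
Qed.

Lemma pair_in_cell (p : A * B) : exists2 c, c \in cells Pi & p \in c.
Proof.
have /and3P[/eqP cov _ _] := cells_partition Pi.
have: p \in cover (cells Pi) by rewrite cov inE.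
by case/bigcupP=> c cP pc; exists c.
Qed.

End Structure.

Theorem theorem1p1 :
  ~ exists (A B : finType) (Pi : product_structure A B),
      (even_structure Pi \/ odd_structure Pi) /\
      2 <= #|A| /\ 2 <= #|B| /\
      exists O : coherent_orientation Pi, no_fold O /\ triple_girth_T4 O.
Proof.
move=> [A [B [Pi [parity [A2 [B2 [O [nofold girths]]]]]]]].
pose VA : {set A + B} := [set inl a | a : A].
pose VB : {set A + B} := [set inr b | b : B].
have cardA : #|VA| = #|A| by rewrite card_imset //; apply: inl_inj.
have cardB : #|VB| = #|B| by rewrite card_imset //; apply: inr_inj.
have [DA [DB [DA1 DB1 [restA restB] cov]]] : exists DA DB : {set A + B},
    [/\ #|DA| <= 1, #|DB| <= 1, 1 < #|VA :\: DA| /\ 1 < #|VB :\: DB| &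
     forall a b, (inl a \in DA -> inr b \notin DB) ->
       exists s, incident O (inl a) s && incident O (inr b) s].
  case: parity => [even | [c0 c0P [/eqP/cards1P[[a0 b0] def0] odd2]]].
    exists set0, set0; rewrite !cards0 !setD0 cardA cardB; split=> // a b _.
    have [c cP abc] := pair_in_cell Pi (a, b).
    have [a' [b' /two_cell_incident]] := two_cell_of_pair cP (even _ cP) abc.
    exact.
  (* One 1-cell and otherwise 2-cells make |A||B| odd. Both sides then have at least three points,
     so two remain after deleting the exceptional one. *)
  have oddAB : odd (#|A| * #|B|).
    rewrite -card_prod -cardsT (card_partition (cells_partition Pi)).
    rewrite (bigD1 c0) //= def0 cards1 -def0 (eq_bigr (fun _ => 2)).
      by rewrite sum_nat_const oddD oddM andbF.
    by move=> c /andP[]; apply: odd2.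
  have rest (Z : {set A + B}) z : odd #|Z| -> 1 < #|Z| -> 1 < #|Z :\: [set z]|.
    move=> oddZ Z1; have := cardsD1 z Z.
    by case: (z \in Z); move: oddZ Z1; case: #|Z| => [|[|[|]]] //=; lia.
  move: oddAB; rewrite oddM => /andP[oddA oddB].
  exists [set inl a0], [set inr b0]; rewrite !cards1.
  split=> //; first by split; apply: rest; rewrite ?cardA ?cardB.
  move=> a b; rewrite !inE => ab.
  have [c cP abc] := pair_in_cell Pi (a, b).
  have c2 : #|c| = 2.
    apply: odd2 => //; apply/eqP=> eq_c; move: abc ab.
    by rewrite eq_c def0 => /set1P[-> ->]; rewrite !eqxx => /(_ isT).
  have [a' [b' /two_cell_incident]] := two_cell_of_pair cP c2 abc.
  exact.
have clA : link_closed Pi VA.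
  by case=> [a|b] [a'|b'] //= _; rewrite ?imset_f // => /imsetP[].
have clB : link_closed Pi VB.
  by case=> [a|b] [a'|b'] //= _; rewrite ?imset_f // => /imsetP[].
have girth6 : girth_at_least (middle_link O) 6.
  by case: girths => -[_ //]; apply: girth_at_least_leq.
(* Stated for arbitrary sides so that the smaller one can play the role of [X]. *)
have impossible (X Y D E : {set A + B}) :
    link_closed Pi X -> link_closed Pi Y -> #|D| <= 1 -> #|E| <= 1 ->
    (forall x y, x \in X -> y \in Y -> (x \in D -> y \notin E) ->
       exists s, incident O x s && incident O y s) ->
    1 < #|X :\: D| -> 1 < #|Y| -> #|X| <= #|Y| -> False.
  move=> clX clY D1 E1 covXY XD Y1 XY.
  have lin v w s t := @incident_linear _ _ _ O v w s t girth6.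
  have flipN (s : signed_color Pi) : s != flip_sign s.
    by case: s => c b; rewrite xpair_eqE eqxx; case: b.
  have sizes s : line_size (incident O) Y (flip_sign s) = line_size (incident O) Y s.
    exact: line_size_flip.
  have X0 : 0 < #|X|.
    by apply: leq_trans (ltnW XD) _; apply: subset_leq_card; apply: subsetDl.
  have sym := @link_AB_sym _ _ Pi; have irr := @link_AB_irr _ _ Pi.
  (* The second and third alternatives both give middle girth at least 8. *)
  have [link6|girth8] : girth_at_least (link_AB Pi) 6 \/ girth_at_least (middle_link O) 8.
    case: girths => -[g1 g2]; [by left | by right | right].
    exact: girth_at_least_leq g2.
  - apply: (no_girth6_lines sym irr clX (lines_le_degree O) lin flipN sizes
             D1 E1 covXY X0 Y1 XY).
    + by move=> a b c; apply: no_triangle_of_girth => //; apply: girth_at_least_leq link6.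
    + by move=> a b c d; apply: no_square_of_girth => //; apply: girth_at_least_leq link6.
    + by move=> a b c d f; apply: no_pentagon_of_girth.
  - apply: (no_girth8_lines irr clX (lines_le_degree O) lin flipN sizes
             E1 covXY XY) => // u v w r s t.
    exact: incident_no_hexagon.
have [AB|/ltnW BA] := leqP #|A| #|B|.
  apply: (impossible VA VB DA DB); rewrite ?cardA ?cardB //.
  by move=> _ _ /imsetP[a _ ->] /imsetP[b _ ->]; apply: cov.
apply: (impossible VB VA DB DA); rewrite ?cardA ?cardB //.
move=> _ _ /imsetP[b _ ->] /imsetP[a _ ->] ba.
have [|s] := cov a b; last by exists s; rewrite andbC.
by move=> aD; apply/negP=> /ba; rewrite aD.
Qed.
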